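(* Let $\mathbb T,\mathbb S$ be guarded monads on a category with finite coproducts, let $\rho\colon\mathbb T\to\mathbb S$ be a guarded retraction witnessed by $(\upsilon_X\colon SX\to TX)_X$, and suppose $\mathbb T$ is guarded pre-iterative with iteration operator $(-)^\dagger$. Then $\mathbb S$ is guarded pre-iterative with the iteration operator $f\mapsto f^{\ddagger}=\rho_Y\circ(\upsilon_{Y+X}\circ f)^\dagger$ for $f\colon X\to_{\mathrm{inr}}S(Y+X)$.
   Context: Monads have unit $\eta$ and Kleisli lifting $(-)^*$. A summand $\sigma$ of $Y$ is a pair of morphisms exhibiting $Y$ as a coproduct. A guarded monad $\mathbb T$ has a relation $f\colon X\to_\sigma TY$ closed under (trv) $T(\mathrm{inl})\circ f\colon X\to_{\mathrm{inr}}T(Y+Z)$ for all $f\colon X\to TY$; (par) $f\colon X\to_\sigma TZ$, $g\colon Y\to_\sigma TZ$ imply $[f,g]\colon X+Y\to_\sigma TZ$; (cmp) $f\colon X\to_{\mathrm{inr}}T(Y+Z)$, $g\colon Y\to_\sigma TV$, $h\colon Z\to TV$ imply $[g,h]^*\circ f\colon X\to_\sigma TV$. It is guarded pre-iterative if equipped with an operator assigning to each $f\colon X\to_{\mathrm{inr}}T(Y+X)$ some $f^\dagger\colon X\to TY$ with $f^\dagger=[\eta,f^\dagger]^*\circ f$. A monad morphism $\rho\colon\mathbb T\to\mathbb S$ is a guarded retraction if there is a family $(\upsilon_X\colon SX\to TX)_X$ (not necessarily natural) with $\rho_X\circ\upsilon_X=\mathrm{id}$ and such that $f\colon X\to_\sigma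 SY$ implies $\upsilon_Y\circ f\colon X\to_\sigma TY$. *)

(* Defs.v *)
Set Implicit Arguments.
Unset Strict Implicit.
Unset Printing Implicit Defensive.

Declare Scope cat_scope.
Delimit Scope cat_scope with cat.
Open Scope cat_scope.

Record category := Category {
  ob :> Type;
  hom : ob -> ob -> Type;
  id : forall X, hom X X;
  comp : forall X Y Z, hom Y Z -> hom X Y -> hom X Z;
  comp_id_l : forall X Y (f : hom X Y), comp (id Y) f = f;
  comp_id_r : forall X Y (f : hom X Y), comp f (id X) = f;
  comp_assoc : forall X Y Z W (h : hom Z W) (g : hom Y Z) (f : hom X Y),
    comp h (comp g f) = comp (comp h g) f
}.

Arguments hom {c} X Y.
Arguments id {c} X.
Arguments comp {c X Y Z} g f.

Notation "X ~> Y" := (hom X Y) (at level 60, no associativity) : cat_scope.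
Notation "g ∘ f" := (comp g f) (at level 40, left associativity) : cat_scope.

Definition is_coproduct (C : category) (Y1 Y2 Y : C)
    (i1 : Y1 ~> Y) (i2 : Y2 ~> Y) : Prop :=
  forall (Z : C) (f : Y1 ~> Z) (g : Y2 ~> Z),
    exists! h : Y ~> Z, h ∘ i1 = f /\ h ∘ i2 = g.

Record cocartesian := Cocartesian {
  cc_cat :> category;
  zero : cc_cat;
  from_zero : forall X : cc_cat, zero ~> X;
  from_zero_unique : forall (X : cc_cat) (f : zero ~> X), f = from_zero X;
  coprod : cc_cat -> cc_cat -> cc_cat;
  inl : forall X Y, X ~> coprod X Y;
  inr : forall X Y, Y ~> coprod X Y;
  copair : forall X Y Z : cc_cat, X ~> Z -> Y ~> Z -> coprod X Y ~> Z;
  copair_inl : forall (X Y Z : cc_cat) (f : X ~> Z) (g : Y ~> Z),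
    copair f g ∘ inl X Y = f;
  copair_inr : forall (X Y Z : cc_cat) (f : X ~> Z) (g : Y ~> Z),
    copair f g ∘ inr X Y = g;
  copair_unique : forall (X Y Z : cc_cat) (f : X ~> Z) (g : Y ~> Z)
      (h : coprod X Y ~> Z),
    h ∘ inl X Y = f -> h ∘ inr X Y = g -> h = copair f g
}.

Arguments coprod {c} X Y.
Arguments inl {c} X Y.
Arguments inr {c} X Y.
Arguments copair {c X Y Z} f g.

Notation "X ⊕ Y" := (coprod X Y) (at level 50, left associativity) : cat_scope.
Notation "[| f , g |]" := (copair f g) (at level 0) : cat_scope.

(** A summand, written σ : Y1 ↪ Y in the literature, is named after its first
    injection; the second one is its complement. *)
Record summand (C : category) (Y : C) := Summand {
  part : C;
  copart : C;
  part_inj : part ~> Y;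
  copart_inj : copart ~> Y;
  summandP : is_coproduct part_inj copart_inj
}.

Lemma inr_is_coproduct (C : cocartesian) (Y Z : C) :
  is_coproduct (inr Y Z) (inl Y Z).
Proof.
  intros W f g. exists [| g, f |]. split.
  - split; [apply copair_inr | apply copair_inl].
  - intros h [h1 h2]. symmetry. now apply copair_unique.
Qed.

Definition inr_summand (C : cocartesian) (Y Z : C) : summand (Y ⊕ Z) :=
  Summand (@inr_is_coproduct C Y Z).

Record monad (C : category) := Monad {
  mob :> C -> C;
  unit : forall X : C, X ~> mob X;
  lift : forall X Y : C, X ~> mob Y -> mob X ~> mob Y;
  lift_unit : forall X : C, lift (unit X) = id (mob X);
  lift_comp_unit : forall (X Y : C) (f : X ~> mob Y), lift f ∘ unit X = f;
  lift_comp_lift : forall (X Y Z : C) (g : Y ~> mob Z) (f : X ~> mob Y),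
    lift g ∘ lift f = lift (lift g ∘ f)
}.

Arguments unit {C} m X.
Arguments lift {C} m {X Y} f.

Definition fmap (C : category) (T : monad C) (X Y : C) (f : X ~> Y) :
    T X ~> T Y :=
  lift T (unit T Y ∘ f).

Arguments fmap {C} T {X Y} f.

(** The Kleisli-triple form of a monad morphism; naturality follows. *)
Record monad_morphism (C : category) (T S : monad C) := MonadMorphism {
  mm_app :> forall X : C, T X ~> S X;
  mm_unit : forall X : C, mm_app X ∘ unit T X = unit S X;
  mm_lift : forall (X Y : C) (f : X ~> T Y),
    mm_app Y ∘ lift T f = lift S (mm_app Y ∘ f) ∘ mm_app X
}.

(** [guarded s f] is f : X →_s TY. *)
Record guarded_monad (C : cocartesian) := GuardedMonad {
  gm_monad :> monad C;
  guarded : forall X Y : C, summand Y -> X ~> gm_monad Y -> Prop;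
  guarded_trv : forall (X Y Z : C) (f : X ~> gm_monad Y),
    guarded (inr_summand Y Z) (fmap gm_monad (inl Y Z) ∘ f);
  guarded_par : forall (X Y Z : C) (s : summand Z)
      (f : X ~> gm_monad Z) (g : Y ~> gm_monad Z),
    guarded s f -> guarded s g -> guarded s [| f, g |];
  guarded_cmp : forall (X Y Z V : C) (s : summand V)
      (f : X ~> gm_monad (Y ⊕ Z)) (g : Y ~> gm_monad V) (h : Z ~> gm_monad V),
    guarded (inr_summand Y Z) f -> guarded s g ->
    guarded s (lift gm_monad [| g, h |] ∘ f)
}.

Arguments guarded {C} T {X Y} s f : rename.

(** Not a total function on X ~> T (Y ⊕ X): X ~> T Y may be empty. *)
Definition iteration (C : cocartesian) (T : guarded_monad C) : Type :=
  forall (X Y : C) (f : X ~> T (Y ⊕ X)),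
    guarded T (inr_summand Y X) f -> X ~> T Y.

Definition pre_iterative (C : cocartesian) (T : guarded_monad C)
    (iter : iteration T) : Prop :=
  forall (X Y : C) (f : X ~> T (Y ⊕ X))
      (gf : guarded T (inr_summand Y X) f),
    iter X Y f gf = lift T [| unit T Y, iter X Y f gf |] ∘ f.

Record guarded_retraction (C : cocartesian) (T S : guarded_monad C)
    (rho : monad_morphism T S) (ups : forall X : C, S X ~> T X) : Prop :=
  GuardedRetraction {
    retraction_id : forall X : C, rho X ∘ ups X = id (S X);
    retraction_guarded : forall (X Y : C) (s : summand Y) (f : X ~> S Y),
      guarded S s f -> guarded T s (ups Y ∘ f)
  }.

(* Main.v *)
Require Import Defs.

(** Unfold the fixpoint equation of [dagger] once in [T] and push [rho] through it: as [rho]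
    preserves Kleisli lifting and units, [rho] turns [[η, d]^* ∘ ups ∘ f] into [[η, rho ∘ d]^* ∘ rho
    ∘ ups ∘ f], and [rho ∘ ups = id] leaves [f]. *)

Lemma comp_copair (C : cocartesian) (X Y Z W : C) (h : Z ~> W)
    (f : X ~> Z) (g : Y ~> Z) :
  h ∘ [| f, g |] = [| h ∘ f, h ∘ g |].
Proof.
  apply copair_unique; rewrite <- comp_assoc.
  - now rewrite copair_inl.
  - now rewrite copair_inr.
Qed.

Theorem theorem5p4 (C : cocartesian) (T S : guarded_monad C)
    (rho : monad_morphism T S) (ups : forall X : C, S X ~> T X)
    (retr : guarded_retraction rho ups)
    (dagger : iteration T) (dagger_fix : pre_iterative dagger) :
  pre_iterative (T := S)
    (fun (X Y : C) (f : X ~> S (Y ⊕ X))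
         (gf : guarded S (inr_summand Y X) f) =>
       rho Y ∘ dagger X Y (ups (Y ⊕ X) ∘ f) (retraction_guarded retr gf)).
Proof.
  intros X Y f gf.
  (* Only the left occurrence of [dagger] is to be unfolded; the same term recurs on the right and
     must stay. *)
  etransitivity.
  - apply f_equal, dagger_fix.
  - now rewrite comp_assoc, mm_lift, comp_copair, mm_unit, <- comp_assoc,
      (comp_assoc (rho _)), (retraction_id retr), comp_id_l.
Qed.
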